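(* Let $(K,v)$ be a henselian valued field and let $F,G\in\mathbb{P}^{\mathrm{dless}}$ be separable and Okutsu equivalent. For $\theta\in Z(F)$, take $\omega\in Z(G)$ such that $v(\theta-\omega)=\max\{v(\theta-\omega')\mid\omega'\in Z(G)\}$. Then $K(\theta)^{\mathrm{tame}}=K(\omega)^{\mathrm{tame}}$.
   Context: $(K,v)$ is henselian with value group $\Gamma$; $v$ also denotes its unique extension to a fixed algebraic closure $\overline{K}$, with values in $\mathbb{Q}\Gamma\cup\{\infty\}$, $\mathbb{Q}\Gamma=\Gamma\otimes\mathbb{Q}$. For a monic irreducible $F\in K[x]$, $Z(F)$ is the (multi)set of its roots in $\overline{K}$, $e(F)$ and $f(F)$ are the ramification index and residual degree of $K[x]/(F)$ over $K$, and $F$ is defectless if $\deg F=e(F)f(F)$. $\mathbb{P}^{\mathrm{dless}}$ is the set of monic irreducible defectless polynomials in $K[x]$ of degree greater than one. $v_F(f):=v(f(\theta))$ for any $\theta\in Z(F)$ (independent of $\theta$). For $F\in\mathbb{P}^{\mathrm{dless}}$, $w(F)=\max\{v_F(g)/\deg g\mid g\in K[x]\text{ monic},\ 0<\deg g<\deg F\}$ (the maximum exists for defectless $F$) and $\delta_0(F)=\deg(F)\,w(F)$. $F,G\in\mathbb{P}^{\mathrm{dless}}$ are Okutsu equivalent, $F\approx G$, if $\deg F=\deg G$ and $v_F(G)>\delta_0(F)$. For $a,b\in\overline{K}$ with $a\neq 0$, $a\sim_v b$ means $v(a-b)>v(a)$ (and $0\sim_v0$). Let $K^s\subset\overline{K}$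 be the separable closure of $K$ and $G^{\mathrm{tame}}=\{\sigma\in\operatorname{Gal}(K^s/K)\mid\sigma(c)\sim_v c\ \text{for all } c\in K^s\}$. For an algebraic extension $L/K$ inside $\overline{K}$, $L^{\mathrm{tame}}:=L\cap(K^s)^{G^{\mathrm{tame}}}$, the maximal tame subextension of $L/K$. *)

(* Defs.v *)
From HB Require Import structures.
From mathcomp Require Import all_boot all_order all_algebra all_field.
From mathcomp Require Import boolp classical_sets functions.

Set Implicit Arguments.
Unset Strict Implicit.
Unset Printing Implicit Defensive.

Import Order.TTheory GRing.Theory Num.Theory.
Local Open Scope classical_set_scope.
Local Open Scope ring_scope.

(* Divisible ordered abelian groups, i.e. totally ordered Q-vector spaces.
   Compatibility of the order with positive rational scalars follows from
   translation invariance. *)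
HB.mixin Record isOrderedRatModule D
    of Order.POrder ring_display D & GRing.Lmodule rat D := {
  ordrat_le_total : forall x y : D, (x <= y) || (y <= x);
  ordrat_leD2l : forall x y z : D, x <= y -> z + x <= z + y
}.

#[short(type="orderedRatModType")]
HB.structure Definition OrderedRatModule :=
  { D of Order.POrder ring_display D & GRing.Lmodule rat D
         & isOrderedRatModule D }.

(* D with a top element: [Some d] is the finite value d, [None] is infinity. *)
Definition ext (D : Type) : Type := option D.

Section ExtOrder.
Variable D : orderedRatModType.
Implicit Types a b c : ext D.

HB.instance Definition _ := Choice.on (ext D).

Definition ext_le a b : bool :=
  match a, b with
  | _, None => true
  | None, Some _ => false
  | Some x, Some y => x <= y
  end.

Definition ext_lt a b : bool := (b != a) && ext_le a b.
Definition ext_min a b : ext D := if ext_lt a b then a else b.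
Definition ext_max a b : ext D := if ext_lt a b then b else a.

Fact ext_le_anti : antisymmetric ext_le.
Proof. by case=> [x|] [y|] //= /le_anti ->. Qed.

Fact ext_le_trans : transitive ext_le.
Proof. by case=> [x|] [y|] [z|] //=; apply: le_trans. Qed.

Fact ext_le_total : total ext_le.
Proof. by case=> [x|] [y|] //=; apply: ordrat_le_total. Qed.

HB.instance Definition _ := Order.isOrder.Build ring_display (ext D)
  (fun=> fun=> erefl) (fun=> fun=> erefl) (fun=> fun=> erefl)
  ext_le_anti ext_le_trans ext_le_total.

Definition ext_add a b : ext D :=
  if a is Some x then if b is Some y then Some (x + y) else None else None.

(* The quotient a / n, for n > 0. *)
Definition ext_divn a (n : nat) : ext D :=
  if a is Some x then Some (n%:R^-1 *: x) else None.

End ExtOrder.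

Section Valuations.
Variables (D : orderedRatModType) (E : fieldType).

Record is_valuation (v : E -> ext D) : Prop := IsValuation {
  val_infty : forall x, v x = None <-> x = 0;
  val_mul : forall x y, v (x * y) = ext_add (v x) (v y);
  val_add : forall x y, Order.min (v x) (v y) <= v (x + y)
}.

Definition value_group (v : E -> ext D) (L : set E) : set D :=
  [set d | exists2 x, L x & v x = Some d].

(* As D is a Q-vector space, this says that the map from
   (value group of v) (x) Q to D is an isomorphism. *)
Definition is_divisible_hull (v : E -> ext D) : Prop :=
  forall d : D, exists2 n : nat, (0 < n)%N & value_group v setT (d *+ n).

Definition sim_val (v : E -> ext D) (a b : E) : Prop :=
  if a == 0 then b = 0 else v a < v (a - b).

End Valuations.

Definition deg (R : nzRingType) (p : {poly R}) : nat := (size p).-1.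

Section Extension.
Variables (D : orderedRatModType) (K : fieldType) (Kbar : closedFieldType).
Variable iota : {rmorphism K -> Kbar}.

Definition is_algebraic_closure : Prop :=
  forall x : Kbar, algebraicOver iota x.

Definition extends_val (v : K -> ext D) (w : Kbar -> ext D) : Prop :=
  is_valuation w /\ forall a, w (iota a) = v a.

(* Every extension of v to Kbar takes its values in the divisible hull of the
   value group of v, so D-valued extensions are all of them. *)
Definition henselian (v : K -> ext D) : Prop :=
  is_valuation v /\ exists! w : Kbar -> ext D, extends_val v w.

Local Notation "p ^i" := (map_poly iota p) (at level 2, format "p ^i").

Definition Zroots (F : {poly K}) : seq Kbar :=
  sval (closed_field_poly_normal F^i).

Definition adjoin (theta : Kbar) : set Kbar :=
  [set x | exists g h : {poly K}, h^i.[theta] != 0 /\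
                                  x = g^i.[theta] / h^i.[theta]].

(* From here on, v is the valuation of Kbar; its restriction to K is v \o iota. *)
Variable v : Kbar -> ext D.

Definition chosen_root (F : {poly K}) : Kbar := head 0 (Zroots F).

Definition v_at (F f : {poly K}) : ext D := v f^i.[chosen_root F].

(* s is a system of representatives of the classes of v(L^* ) mod v(K^* ). *)
Definition is_ramification_index (L : set Kbar) (e : nat) : Prop :=
  let GL := value_group v L in
  let GK := value_group v (range iota) in
  exists s : e.-tuple D,
  [/\ forall i, GL (tnth s i),
      forall i j, GK (tnth s i - tnth s j) -> i = j &
      forall d, GL d -> exists i, GK (d - tnth s i)].

(* The residue classes of b form a basis of the residue field of L over that
   of K: a residue class of an integral y vanishes iff v y > 0. *)
Definition is_residue_degree (L : set Kbar) (f : nat) : Prop :=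
  let integral (y : Kbar) := (Some 0 : ext D) <= v y in
  let res0 (y : Kbar) := (Some 0 : ext D) < v y in
  exists b : f.-tuple Kbar,
  [/\ forall i, L (tnth b i) /\ integral (tnth b i),
      forall c : 'I_f -> K, (forall i, integral (iota (c i))) ->
        res0 (\sum_i iota (c i) * tnth b i) -> forall i, res0 (iota (c i)) &
      forall y, L y -> integral y ->
        exists2 c : 'I_f -> K, forall i, integral (iota (c i)) &
          res0 (y - \sum_i iota (c i) * tnth b i)].

Definition defectless (F : {poly K}) : Prop :=
  exists e f : nat,
  [/\ is_ramification_index (adjoin (chosen_root F)) e,
      is_residue_degree (adjoin (chosen_root F)) f &
      deg F = (e * f)%N].

Record Pdless (F : {poly K}) : Prop := IsPdless {
  Pdless_monic : F \is monic;
  Pdless_irr : irreducible_poly F;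
  Pdless_deg : (1 < deg F)%N;
  Pdless_defectless : defectless F
}.

(* w = w(F); this is a relation because the maximum is only known to exist for
   defectless F. *)
Definition is_weight (F : {poly K}) (w : D) : Prop :=
  let test (g : {poly K}) := g \is monic /\ (0 < deg g < deg F)%N in
  (exists2 g, test g & ext_divn (v_at F g) (deg g) = Some w) /\
  (forall g, test g -> ext_divn (v_at F g) (deg g) <= (Some w : ext D)).

Definition is_delta0 (F : {poly K}) (d : D) : Prop :=
  exists2 w, is_weight F w & d = w *+ deg F.

Definition okutsu_equiv (F G : {poly K}) : Prop :=
  deg F = deg G /\ exists2 d, is_delta0 F d & (Some d : ext D) < v_at F G.

Definition Ksep : set Kbar :=
  [set x | exists p : {poly K},
    [/\ p \is monic, irreducible_poly p, separable_poly p & root p^i x]].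

(* Only the restriction of sigma to Ksep matters. *)
Record is_gal (sigma : Kbar -> Kbar) : Prop := IsGal {
  gal_bij : set_bij Ksep Ksep sigma;
  gal_add : forall x y, Ksep x -> Ksep y -> sigma (x + y) = sigma x + sigma y;
  gal_mul : forall x y, Ksep x -> Ksep y -> sigma (x * y) = sigma x * sigma y;
  gal_fix : forall a, sigma (iota a) = iota a
}.

Definition Gtame : set (Kbar -> Kbar) :=
  [set sigma | is_gal sigma /\ forall c, Ksep c -> sim_val v (sigma c) c].

Definition Ksep_Gtame : set Kbar :=
  [set c | Ksep c /\ forall sigma, Gtame sigma -> sigma c = c].

Definition tame_part (L : set Kbar) : set Kbar := L `&` Ksep_Gtame.

End Extension.

(* Main.v *)
From HB Require Import structures.
Require Import Defs.
From mathcomp Require Import all_boot all_order all_fingroup all_algebra all_field.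
From mathcomp Require Import boolp classical_sets functions.

(** Write [x ~ y] for [sim_val v x y]: the elements [x] and [y] have the same
    leading term. Endomorphisms of the algebraic closure over [K] preserve
    [v], since the extension of [v] is unique.

    First, an element [alpha] of degree less than [deg F] is strictly further
    from [theta] than [omega] is ([okutsu_root_closer]). Otherwise
    [v (theta - sigma omega) <= v (theta - sigma alpha)] for every
    [K]-endomorphism [sigma]; averaging over the conjugates, the minimal
    polynomial [p] of [alpha] satisfies
    [v(G(theta)) / deg G <= v(p(theta)) / deg p], which contradicts
    [v_F(G) > deg F * w(F)]. Factoring [g] into linear factors, it follows that
    [g(theta) ~ g(omega)] whenever [deg g < deg F] ([okutsu_sim_horner]).

    Let then [c] be a tame element of [K(theta)], and [sigma] an endomorphism
    fixing [K(omega)]. Every [x] in [K(theta)] is [~] to an element fixed by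
    [sigma], so [sigma x ~ x] on [K(theta)]. The heart of the proof is that
    such a partial embedding, moving nothing up to [~], extends to an element
    of the tame ramification group ([tame_extension]). That extension fixes
    [c], so [sigma c = c]; as [c] is separable over [K], it lies in
    [K(omega)]. The relation between [theta] and [omega] is symmetric, which
    gives the other inclusion ([tame_part_subset]).

    To prove [tame_extension], take a maximal partial embedding [rho] of a
    field [L] with [rho x ~ x], and suppose that some element is not [~] to any
    element of [L]. Choose such a [y] of minimal degree, with minimal
    polynomial [f]. The coefficients of [f] and [rho f] agree up to [~] and all
    their roots have the value [v y], so [rho f] has a root [y' ~ y]
    ([exists_sim_root]). By minimality the roots [z] of any polynomial [g] of
    smaller degree are [~] to elements of [L], so there is no cancellation in
    [y - z], and [g(y) ~ (rho g)(y')] ([sim_horner]). Hence [y |-> y'] extends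
    [rho], a contradiction. So every element is [~] to one of [L], and then any
    extension of [rho] to the algebraic closure moves nothing up to [~]. *)

Import Order.TTheory GRing.Theory Num.Theory.
Local Open Scope classical_set_scope.
Local Open Scope ring_scope.
Set Implicit Arguments.
Unset Strict Implicit.
Unset Printing Implicit Defensive.

Local Notation "p ^ f" := (map_poly f p) : ring_scope.

(** * Values in an ordered group with infinity *)

Section Ext.
Variable D : orderedRatModType.
Implicit Types (a b c : ext D) (d : D).

Lemma ext_addC : commutative (@ext_add D).
Proof. by case=> [x|] [y|] //=; rewrite addrC. Qed.

Lemma ext_leS d1 d2 : ((Some d1 : ext D) <= Some d2) = (d1 <= d2).
Proof. by []. Qed.

Lemma ext_lte_None a : (a < (None : ext D)) = (a != None).
Proof. by rewrite lt_neqAle; case: a. Qed.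

Lemma ext_le_None a : a <= (None : ext D).
Proof. by case: a. Qed.

Lemma ext_leDl c a b : a <= b -> ext_add c a <= ext_add c b.
Proof.
case: c a b => [z|] [x|] [y|] //=.
by rewrite !ext_leS; apply: ordrat_leD2l.
Qed.

Lemma ext_ltDl c a b : c != None -> a < b -> ext_add c a < ext_add c b.
Proof.
move=> c0 ab; rewrite lt_neqAle ext_leDl ?(ltW ab) // andbT.
move: ab; rewrite lt_neqAle => /andP[nab _]; apply: contraNneq nab.
case: c a b c0 => [z|] [x|] [y|] //= _ [] /addrI -> //.
Qed.

Lemma ext_ltD a b c e : a <= b -> c < e -> a != None ->
  ext_add a c < ext_add b e.
Proof.
move=> ab ce a0; apply: (lt_le_trans (ext_ltDl a0 ce)).
by rewrite ![ext_add _ e]ext_addC ext_leDl.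
Qed.

Lemma ext_leD a b c e : a <= b -> c <= e -> ext_add a c <= ext_add b e.
Proof.
move=> ab ce; apply: (le_trans (ext_leDl a ce)).
by rewrite ![ext_add _ e]ext_addC ext_leDl.
Qed.

Lemma ext_le_divn a n d : (0 < n)%N ->
  (ext_divn a n <= (Some d : ext D)) -> a <= Some (d *+ n).
Proof.
case: a => [x|] //= n0; rewrite !ext_leS => le_d.
have {le_d} : forall k, (n%:R^-1 *: x) *+ k <= d *+ k.
  elim=> [|k IHk]; first exact: (le_refl (Some 0 : ext D)).
  rewrite !mulrS.
  exact: (@ext_leD (Some _) (Some _) (Some _) (Some _) le_d IHk).
move/(_ n); rewrite -scaler_nat scalerA mulfV ?scale1r //.
by rewrite pnatr_eq0 -lt0n.
Qed.

End Ext.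

(** * Valuations and equality of leading terms *)

Section Val.
Variables (D : orderedRatModType) (E : fieldType) (v : E -> ext D).
Hypothesis vP : is_valuation v.
Implicit Types x y z : E.

Lemma valuation0 : v 0 = None. Proof. exact/(val_infty vP). Qed.

Lemma valuationM x y : v (x * y) = ext_add (v x) (v y).
Proof. exact: (val_mul vP). Qed.

Lemma valuation_eq0 x : (v x == None) = (x == 0).
Proof. by apply/eqP/eqP => /(val_infty vP). Qed.

Lemma valuation1 : v 1 = Some 0.
Proof.
have := valuationM 1 1; rewrite mulr1; have := valuation_eq0 1; rewrite oner_eq0.
case: (v 1) => [d|] //= _ [] /eqP.
by rewrite -{1}[d]addr0 => /eqP /addrI ->.
Qed.

(** As [v (-1) + v (-1) = v 1 = 0], division by 2 in the value space gives
    [v (-1) = 0]. *)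
Lemma valuationN x : v (- x) = v x.
Proof.
suff vN1 : v (-1) = Some 0.
  by rewrite -mulN1r valuationM vN1; case: (v x) => //= d; rewrite add0r.
have := valuationM (-1) (-1); rewrite mulrNN mulr1 valuation1.
case: (v (-1)) => [d|] //= [] /esym d2; congr Some.
have : (2%:R^-1 : rat) *: (d *+ 2) = 0 by rewrite [d *+ 2]mulr2n d2 scaler0.
by rewrite -scaler_nat scalerA mulVf ?scale1r.
Qed.

Lemma valuationB x y : v (x - y) = v (y - x). Proof. by rewrite -valuationN opprB. Qed.

Lemma valuationD_gt a x y : a < v x -> a < v y -> a < v (x + y).
Proof. by move=> ax ay; apply: lt_le_trans (val_add vP x y); rewrite lt_min ax. Qed.

Lemma valuationD_ge a x y : a <= v x -> a <= v y -> a <= v (x + y).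
Proof. by move=> ax ay; apply: le_trans (val_add vP x y); rewrite le_min ax. Qed.

Lemma valuationX_le2 x y k : v x <= v y -> v (x ^+ k) <= v (y ^+ k).
Proof.
move=> xy; elim: k => [|k IHk]; first by rewrite !expr0.
by rewrite !exprS !valuationM ext_leD.
Qed.

Lemma valuationX_le x d k : v x <= Some d -> v (x ^+ k) <= Some (d *+ k).
Proof.
move=> xd; elim: k => [|k IHk]; first by rewrite expr0 valuation1.
by rewrite exprS valuationM mulrS; apply: (ext_leD xd IHk).
Qed.

Lemma valuationX_gt x d k : (0 < k)%N -> (Some d : ext D) < v x ->
  (Some (d *+ k) : ext D) < v (x ^+ k).
Proof.
move=> + dx; elim: k => [//|[_ _|k IHk _]]; first by rewrite expr1 mulr1n.
by rewrite exprS valuationM mulrS; apply: (ext_ltD (ltW dx) (IHk isT)).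
Qed.

Lemma valuation_prod_le (I : Type) (r : seq I) (P : pred I) (f g : I -> E) :
  (forall i, P i -> v (f i) <= v (g i)) ->
  v (\prod_(i <- r | P i) f i) <= v (\prod_(i <- r | P i) g i).
Proof.
move=> fg; apply: (big_ind2 (fun x y => v x <= v y)) => // x1 x2 y1 y2 ? ?.
by rewrite !valuationM ext_leD.
Qed.

Local Notation "x \sim y" := (sim_val v x y) (at level 70).

Lemma sim_refl x : x \sim x.
Proof.
rewrite /sim_val; case: eqP => // /eqP x0.
by rewrite subrr valuation0 ext_lte_None valuation_eq0.
Qed.

Lemma sim_gt x y : x != 0 -> (x \sim y) = (v x < v (x - y)).
Proof. by rewrite /sim_val => /negPf ->. Qed.

Lemma sim0 y : 0 \sim y -> y = 0.
Proof. by rewrite /sim_val eqxx. Qed.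

Lemma valuationD_lt x y : v x < v y -> v (x + y) = v x.
Proof.
move=> xy; apply/eqP; rewrite eq_le valuationD_ge ?(ltW xy) // andbT.
rewrite leNgt; apply/negP => lt_x.
have : v x < v ((x + y) - y) by rewrite valuationD_gt // valuationN.
by rewrite addrK ltxx.
Qed.

Lemma sim_val_eq x y : x \sim y -> v x = v y.
Proof.
have [->|x0] := eqVneq x 0; first by move/sim0 ->.
rewrite sim_gt // => lt_x.
by rewrite -[y](subrK x) addrC valuationD_lt // valuationB.
Qed.

Lemma sim_neq0 x y : x \sim y -> (x == 0) = (y == 0).
Proof. by move/sim_val_eq => xy; rewrite -!valuation_eq0 xy. Qed.

Lemma sim_sym x y : x \sim y -> y \sim x.
Proof.
move=> xy; have [y0|y0] := eqVneq y 0.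
  by move: (sim_neq0 xy); rewrite y0 eqxx => /eqP ->; apply: sim_refl.
rewrite sim_gt // -(sim_val_eq xy) valuationB -sim_gt //.
by rewrite (sim_neq0 xy).
Qed.

Lemma sim_trans y x z : x \sim y -> y \sim z -> x \sim z.
Proof.
have [->|x0] := eqVneq x 0; first by move/sim0 ->.
move=> xy yz; have y0 : y != 0 by rewrite -(sim_neq0 xy).
have vxy := sim_val_eq xy; move: xy yz; rewrite !sim_gt // -vxy => xy yz.
by rewrite -[x - z](subrKA y) valuationD_gt.
Qed.

Lemma sim_mul x y x' y' : x \sim y -> x' \sim y' -> x * x' \sim y * y'.
Proof.
have mul_l z a b : a \sim b -> z * a \sim z * b.
  have [->|z0] := eqVneq z 0; first by rewrite !mul0r => _; apply: sim_refl.
  have [->|a0] := eqVneq a 0; first by move/sim0 ->; apply: sim_refl.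
  rewrite !sim_gt ?mulf_neq0 // -mulrBr !valuationM => lt_a.
  by rewrite ext_ltDl // valuation_eq0.
move=> xy xy'; apply: (@sim_trans (x * y')); first exact: mul_l.
by rewrite ![_ * y']mulrC; apply: mul_l.
Qed.

Lemma sim_prod (I : Type) (r : seq I) (f g : I -> E) (P : pred I) :
  (forall i, P i -> f i \sim g i) ->
  \prod_(i <- r | P i) f i \sim \prod_(i <- r | P i) g i.
Proof.
move=> fg; apply: (big_ind2 (sim_val v)) => //; first exact: sim_refl.
by move=> x1 x2 y1 y2; apply: sim_mul.
Qed.

(** When [x] and [y] have different leading terms, [v (x - y)] is the minimum
    of [v x] and [v y], so errors of larger value than [x] and [y] stay
    negligible in the difference. *)
Lemma sim_sub x y x' y' : ~ x \sim y -> x \sim x' -> y \sim y' -> x - y \sim x' - y'.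
Proof.
have [->|x0] := eqVneq x 0.
  move=> _ /sim0 -> yy'; rewrite !sub0r -[- y]mulN1r -[- y']mulN1r.
  by apply: sim_mul => //; apply: sim_refl.
have [->|y0] := eqVneq y 0.
  by move=> _ xx' /sim0 ->; rewrite !subr0.
move=> nxy; have xy0 : x - y != 0.
  by apply: contra_notN nxy; rewrite subr_eq0 => /eqP ->; apply: sim_refl.
have [lex ley] : v (x - y) <= v x /\ v (x - y) <= v y.
  split; rewrite leNgt; apply/negP => lt_x.
    by apply: nxy; rewrite sim_gt.
  by apply/nxy/sim_sym; rewrite sim_gt // valuationB.
rewrite !sim_gt // => xx' yy'.
have -> : (x - y) - (x' - y') = (x - x') - (y - y') by rewrite opprD addrACA -opprD.
apply: valuationD_gt; rewrite ?valuationN.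
  exact: le_lt_trans lex xx'.
exact: le_lt_trans ley yy'.
Qed.

End Val.

(** * Partial embeddings of a field as graphs *)

Section GraphField.
Variable E : fieldType.

(** The graph of a field embedding of a subfield of [E] into [E]. The union of
    a chain of graphs is again one, without any choice of values outside the
    subfield, which is what Zorn's lemma needs. *)
Record subfield_graph (R : set (E * E)) : Prop := SubfieldGraph {
  graph1 : R 1;
  graphB : forall p q, R p -> R q -> R (p - q);
  graphM : forall p q, R p -> R q -> R (p * q);
  graphV : forall p, R p -> p.1 != 0 -> R (p.1^-1, p.2^-1);
  graph0 : forall y, R (0, y) -> y = 0
}.

Section Carrier.
Variables (R : set (E * E)) (gR : subfield_graph R).

(** The proof of [subfield_graph R] is an argument so that the closure
    properties can be attached to the predicate as canonical instances. *)
Definition graph_pred of subfield_graph R : {pred E * E} := fun p => `[< R p >].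

Inductive graph_type := GraphType (p : E * E) of p \in graph_pred gR.
Definition graph_val (x : graph_type) := let: GraphType p _ := x in p.

HB.instance Definition _ := [isSub for graph_val].
HB.instance Definition _ := [Choice of graph_type by <:].

Fact graph_subring : subring_closed (graph_pred gR).
Proof.
split=> [|p q /asboolP Rp /asboolP Rq|p q /asboolP Rp /asboolP Rq]; apply/asboolP.
- exact: (graph1 gR).
- exact: (graphB gR).
- exact: (graphM gR).
Qed.
HB.instance Definition _ := GRing.isSubringClosed.Build _ (graph_pred gR) graph_subring.
HB.instance Definition _ := [SubChoice_isSubComNzRing of graph_type by <:].

Fact graph_fst_eq0 (x : graph_type) : ((val x).1 == 0) = (x == 0).
Proof.
rewrite -val_eqE /=; case: x => [[a b]] /= /asboolP Rab.
apply/eqP/eqP=> [a0|[-> _] //]; rewrite {a}a0 in Rab *.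
by rewrite (graph0 gR Rab).
Qed.

Definition graph_inv (x : graph_type) : graph_type :=
  insubd x ((val x).1^-1, (val x).2^-1).

(** If the second projection vanished at [x], then [x / x - 1] would put the
    pair [(0, -1)] in the graph. *)
Fact graph_snd_eq0 (x : graph_type) : x != 0 -> (val x).2 != 0.
Proof.
move=> x0; have a0 : (val x).1 != 0 by rewrite graph_fst_eq0.
have Rx : R (val x) by apply/asboolP; apply: (valP x).
apply: contra_neq (oner_neq0 E) => b0.
have : R ((val x).1 / (val x).1 - 1, (val x).2 / (val x).2 - 1).
  exact: (graphB gR (graphM gR Rx (graphV gR Rx a0)) (graph1 gR)).
rewrite b0 mul0r mulfV // subrr sub0r.
by move/(graph0 gR) => /eqP; rewrite oppr_eq0 => /eqP.
Qed.

Fact graph_mulVf (x : graph_type) : x != 0 -> graph_inv x * x = 1.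
Proof.
move=> x0; have a0 : (val x).1 != 0 by rewrite graph_fst_eq0.
have Rx : R (val x) by apply/asboolP; apply: (valP x).
apply: val_inj; rewrite /= insubdK; last by apply/asboolP; apply: (graphV gR).
by rewrite /GRing.mul /= /mul_pair /= !mulVf // graph_snd_eq0.
Qed.

Fact graph_inv0 : graph_inv 0 = 0.
Proof.
have R0 : R ((0 : E)^-1, (0 : E)^-1).
  by rewrite invr0; apply/asboolP; apply: (valP (0 : graph_type)).
apply: val_inj; rewrite insubdK; last by apply/asboolP; exact: R0.
by congr pair; exact: invr0.
Qed.

HB.instance Definition _ :=
  GRing.ComNzRing_isField.Build graph_type graph_mulVf graph_inv0.
End Carrier.

(** A graph is a field in its own right, with its two projections as
    embeddings; the polynomials over the domain of a partial embedding are
    the polynomials over this field. *)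
Lemma graph_fieldP (R : set (E * E)) : subfield_graph R ->
  exists (L : fieldType) (i rho : {rmorphism L -> E}),
    forall p, R p <-> exists x, p = (i x, rho x).
Proof.
move=> gR; exists (graph_type gR : fieldType).
exists (fst \o val : {rmorphism _ -> _}), (snd \o val : {rmorphism _ -> _}).
move=> p; split=> [Rp|[x ->]].
  have Rp' : p \in graph_pred gR by apply/asboolP.
  by exists (GraphType Rp'); case: p {Rp} Rp'.
by have /asboolP := valP x; rewrite /=; case: (\val x).
Qed.
End GraphField.

(** * Minimal polynomials and extension of embeddings *)

Lemma exists_min_size (R : nzRingType) (P : {poly R} -> Prop) :
  (exists p, P p) -> exists2 p, P p & forall q, P q -> (size p <= size q)%N.
Proof.
move=> [p Pp]; have exn : exists n, `[< exists2 q, P q & size q = n >].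
  by exists (size p); apply/asboolP; exists p.
case: (ex_minnP exn) => n /asboolP[q Pq <-] min_q.
by exists q => // r Pr; apply: min_q; apply/asboolP; exists r.
Qed.

Section Minpoly.
Variables (L E : fieldType) (i : {rmorphism L -> E}).

Lemma exists_monic_irreducible a : algebraicOver i a ->
  exists f, [/\ f \is monic, irreducible_poly f & root (f ^ i) a].
Proof.
move=> [p p0 pa]; have [|f [f0 fa] min_f] :=
    @exists_min_size L (fun f => f != 0 /\ root (f ^ i) a).
  by exists p.
have lc0 : lead_coef f != 0 by rewrite lead_coef_eq0.
have g0 : (lead_coef f)^-1 *: f != 0 by rewrite scaler_eq0 negb_or invr_eq0 lc0.
have ga : root (((lead_coef f)^-1 *: f) ^ i) a.
  by rewrite map_polyZ rootZ // fmorph_eq0 invr_eq0.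
exists ((lead_coef f)^-1 *: f); split=> //.
  by rewrite monicE lead_coefZ mulVf.
apply/(subfx_irreducibleP ga g0) => q qa q0.
by rewrite size_scale ?invr_eq0 //; apply: min_f.
Qed.

Lemma root_irreducible f g a : irreducible_poly f -> root (f ^ i) a ->
  root (g ^ i) a = (f %| g).
Proof.
move=> f_irr fa; apply/idP/idP => [ga|fg]; last first.
  by apply: root_dvdp fa; rewrite dvdp_map.
rewrite -[_ %| _]negbK -irreducible_poly_coprime //; apply/negP => fg.
have : coprimep (f ^ i) (g ^ i) by rewrite coprimep_map.
by move/coprimep_root => /(_ _ fa); rewrite -rootE ga.
Qed.

End Minpoly.

Section BaseChange.
Variables (L M E : fieldType) (i : {rmorphism L -> E}) (j : {rmorphism M -> E}).
Hypothesis ij : forall x, exists y, j y = i x.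

(** The inclusion of the image of [i] in that of [j] is lifted coefficientwise,
    so that no morphism from [L] to [M] has to be built. *)
Lemma map_poly_lift p : exists q, q ^ j = p ^ i.
Proof.
have [s sP] := choice ij; exists (\poly_(k < size p) s p`_k).
apply/polyP => k; rewrite !coef_map coef_poly.
case: ltnP => [_|ltk]; first exact: sP.
by rewrite (nth_default 0 ltk) !raddf0.
Qed.

End BaseChange.

Lemma is_algebraic_closure_sub (L M : fieldType) (E : closedFieldType)
    (i : {rmorphism L -> E}) (j : {rmorphism M -> E}) :
  (forall x, exists y, j y = i x) ->
  is_algebraic_closure i -> is_algebraic_closure j.
Proof.
move=> ij algi a; have [p p0 pa] := algi a.
have [q qp] := map_poly_lift ij p.
by exists q; rewrite ?qp // -(map_poly_eq0 j) qp map_poly_eq0.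
Qed.

Section Extend.
Variable E : closedFieldType.

Lemma range_graph (L : fieldType) (i rho : {rmorphism L -> E}) :
  subfield_graph [set (i x, rho x) | x in setT].
Proof.
split=> [|_ _ [x _ <-] [y _ <-]|_ _ [x _ <-] [y _ <-]|_ [x _ <-] _ /=|y [x _ []]].
- by exists 1; rewrite ?rmorph1.
- by exists (x - y) => //; rewrite !rmorphB.
- by exists (x * y) => //; rewrite !rmorphM.
- by exists x^-1 => //; rewrite !fmorphV.
- by move=> /eqP; rewrite fmorph_eq0 => /eqP -> <-; rewrite rmorph0.
Qed.

(** Sending [a] to [a'] extends [rho]: modulo the minimal polynomial [f] of [a]
    every nonzero polynomial has a Bezout inverse, and the same inverse works
    at [a']. *)
Lemma adjoin_root_graph (L : fieldType) (i rho : {rmorphism L -> E}) f a a' :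
    irreducible_poly f -> root (f ^ i) a -> root (f ^ rho) a' ->
  subfield_graph [set ((g ^ i).[a], (g ^ rho).[a']) | g in setT].
Proof.
move=> f_irr fa fa'.
split=> [|_ _ [g _ <-] [h _ <-]|_ _ [g _ <-] [h _ <-]|_ [g _ <-] /= ga|y [g _ []]].
- by exists 1 => //; rewrite !rmorph1 !hornerC.
- by exists (g - h) => //; rewrite !rmorphB !hornerE.
- by exists (g * h) => //; rewrite !rmorphM !hornerE.
- have : coprimep f g.
    by rewrite irreducible_poly_coprime // -(root_irreducible g f_irr fa).
  move=> /Bezout_eq1_coprimepP[[u w] /= uw]; exists w => //.
  have inv_w (j : {rmorphism L -> E}) b : root (f ^ j) b ->
      (w ^ j).[b] = (g ^ j).[b]^-1.
    move=> /rootP fb; have /(congr1 (fun p => (p ^ j).[b])) := uw.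
    rewrite rmorphD !rmorphM rmorph1 !hornerE fb mulr0 add0r => wg.
    have g0 : (g ^ j).[b] != 0.
      by apply: contra_eqN wg => /eqP ->; rewrite mulr0 eq_sym oner_eq0.
    by rewrite -[LHS](mulfK g0) wg mul1r.
  by rewrite !inv_w.
- move=> /rootP ga <-; apply/rootP.
  by rewrite (root_irreducible g f_irr fa') -(root_irreducible g f_irr fa).
Qed.

(** Zorn's lemma, with a constraint [Q] on pairs: the subfield axioms and [Q]
    only involve finitely many pairs at a time, so they pass to unions of
    chains. *)
Lemma exists_maximal_graph (R0 Q : set (E * E)) :
  subfield_graph R0 -> R0 `<=` Q ->
  exists R, [/\ subfield_graph R, R0 `<=` R, R `<=` Q &
    forall R', subfield_graph R' -> R `<=` R' -> R' `<=` Q -> R' `<=` R].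
Proof.
move=> gR0 R0Q.
(* Adding R0 to each member takes care of the empty chain. *)
pose P R := subfield_graph (R0 `|` R) /\ R0 `|` R `<=` Q.
have [C CP totC|R [[gR RQ] Rmax]] := @Zorn_bigcup _ P.
  pose U := R0 `|` \bigcup_(X in C) X.
  have pairU p q : U p -> U q ->
      exists X, [/\ P X, R0 `|` X `<=` U, (R0 `|` X) p & (R0 `|` X) q].
    have P0 : P set0 by rewrite /P setU0.
    have subU X : C X -> R0 `|` X `<=` U.
      by move=> CX x [|Xx]; [left|right; exists X].
    move=> [R0p|[X CX Xp]] [R0q|[Y CY Yq]].
    - by exists set0; rewrite setU0; split=> // x R0x; left.
    - by exists Y; split; [exact: CP|exact: subU|left|right].
    - by exists X; split; [exact: CP|exact: subU|right|left].
    - case: (totC X Y CX CY) => XY.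
        by exists Y; split; [exact: CP|exact: subU|right; exact: XY|right].
      by exists X; split; [exact: CP|exact: subU|right|right; exact: XY].
  split; last by move=> x [/R0Q//|[X /CP[_ XQ] Xx]]; apply: XQ; right.
  rewrite -/U; split=> [|p q Up Uq|p q Up Uq|p Up|y Uy].
  - by left; exact: graph1.
  - by have [X [[gX _] XU Xp Xq]] := pairU _ _ Up Uq; exact: XU (graphB gX Xp Xq).
  - by have [X [[gX _] XU Xp Xq]] := pairU _ _ Up Uq; exact: XU (graphM gX Xp Xq).
  - by have [X [[gX _] XU Xp _]] := pairU _ _ Up Up => p0; exact: XU (graphV gX Xp p0).
  - by have [X [[gX _] XU Xp _]] := pairU _ _ Uy Uy; exact: (graph0 gX Xp).
exists (R0 `|` R); split=> // R' gR' RR' R'Q.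
have R'E : R0 `|` R' = R' by apply/setUidPr => x R0x; apply: RR'; left.
have RR'' : R `<=` R' by move=> x Rx; apply: RR'; right.
apply: contrapT => nR'R; apply: (Rmax R'); last by rewrite /P R'E.
by split=> // R'R; apply: nR'R => x /R'R; right.
Qed.

(** A maximal graph has full domain, as the minimal polynomial of a missing
    element could be used to extend it. *)
Lemma extend_endomorphism (L : fieldType) (i rho : {rmorphism L -> E}) :
  is_algebraic_closure i ->
  exists sigma : {rmorphism E -> E}, forall x, sigma (i x) = rho x.
Proof.
move=> algi; have [//|R [gR R0R _ Rmax]] :=
  @exists_maximal_graph _ setT (range_graph i rho).
have [M [j [tau RE]]] := graph_fieldP gR.
have ij x : exists y, j y = i x.
  have /RE[y [-> _]] : R (i x, rho x) by apply: R0R; exists x.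
  by exists y.
have j_surj a : exists x, j x = a.
  have [f [_ f_irr fa]] :=
    exists_monic_irreducible (is_algebraic_closure_sub ij algi a).
  have [|a' fa'] := closed_rootP (f ^ tau) _.
    by rewrite size_map_poly; case: f_irr => + _; case: size => [|[]].
  have gR' := adjoin_root_graph f_irr fa fa'.
  have /RE[x [-> _]] : R (a, a'); last by exists x.
  apply: (Rmax _ gR') => //.
    by move=> p /RE[x ->]; exists x%:P => //; rewrite !map_polyC !hornerC.
  by exists 'X => //; rewrite !map_polyX !hornerX.
have [s sK] := choice j_surj.
have Ks : cancel j s by move=> x; apply: (fmorph_inj j); rewrite sK.
pose sA := GRing.isZmodMorphism.Build _ _ s (can2_zmod_morphism Ks sK).
pose sM := GRing.isMonoidMorphism.Build _ _ s (can2_monoid_morphism Ks sK).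
pose sR : {rmorphism E -> M} := HB.pack s sA sM.
exists (tau \o sR : {rmorphism _ -> _}) => x /=.
have /RE[y [-> ->]] : R (i x, rho x) by apply: R0R; exists x.
by rewrite Ks.
Qed.

Lemma extend_endomorphism_root (L : fieldType) (i rho : {rmorphism L -> E}) f a a' :
    is_algebraic_closure i ->
    irreducible_poly f -> root (f ^ i) a -> root (f ^ rho) a' ->
  exists2 sigma : {rmorphism E -> E}, forall x, sigma (i x) = rho x &
    sigma a = a'.
Proof.
move=> algi f_irr fa fa'.
have [M [j [tau RE]]] := graph_fieldP (adjoin_root_graph f_irr fa fa').
have RL x : exists2 y, j y = i x & tau y = rho x.
  have [|y [-> ->]] := (RE (i x, rho x)).1; last by exists y.
  by exists x%:P => //; rewrite !map_polyC !hornerC.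
have ij x : exists y, j y = i x by have [y] := RL x; exists y.
have [sigma sigmaE] := extend_endomorphism tau (is_algebraic_closure_sub ij algi).
exists sigma => [x|]; first by have [y <- <-] := RL x.
have [|y [-> ->]//] := (RE (a, a')).1.
by exists 'X => //; rewrite !map_polyX !hornerX.
Qed.

(** The minimal polynomial of [c] has simple roots, and an endomorphism over
    [L] carries [c] to each of them; so [c] is its only root, and the
    polynomial is linear. *)
Lemma fixed_separable_in_range (L : fieldType) (i : {rmorphism L -> E}) p c :
    is_algebraic_closure i -> separable_poly p -> root (p ^ i) c ->
    (forall sigma : {rmorphism E -> E},
      (forall x, sigma (i x) = i x) -> sigma c = c) ->
  exists x, i x = c.
Proof.
move=> algi p_sep pc fix_c.
have [f [_ f_irr fc]] := exists_monic_irreducible (algi c).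
have f_sep : separable_poly (f ^ i).
  rewrite separable_map; apply: dvdp_separable p_sep.
  by rewrite -(root_irreducible p f_irr fc).
have f0 : f ^ i != 0 by rewrite map_poly_eq0 irredp_neq0.
have [r fE] := closed_field_poly_normal (f ^ i).
have rootf a : root (f ^ i) a = (a \in r).
  by rewrite fE rootZ ?lead_coef_eq0 // root_prod_XsubC.
have all_c a : a \in r -> a = c.
  rewrite -rootf => fa; have [sigma sL <-] :=
    extend_endomorphism_root algi f_irr fc fa.
  exact: fix_c.
have uniq_r : uniq r.
  rewrite -separable_prod_XsubC; apply: dvdp_separable f_sep.
  by rewrite [X in _ %| X]fE dvdpZr ?lead_coef_eq0.
have rE : r = [:: c].
  have : c \in r by rewrite -rootf.
  case: r {fE rootf} all_c uniq_r => [//|a [|b r]] all_c.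
    by rewrite (all_c a) ?mem_head.
  rewrite /= !inE (all_c a) ?mem_head // (all_c b) ?eqxx //.
  by rewrite !inE eqxx orbT.
move: fE; rewrite rE big_seq1 => /polyP fE.
have l0 : lead_coef f != 0 by rewrite lead_coef_eq0 irredp_neq0.
exists (- (f`_0 / lead_coef f)).
have := fE 0%N; rewrite coef_map coefZ lead_coef_map coefB coefX coefC /= sub0r mulrN => /eqP.
rewrite rmorphN fmorph_div /= => /eqP ->.
by rewrite mulNr opprK mulrC mulKf // fmorph_eq0.
Qed.

End Extend.

(** * Polynomials with similar coefficients *)

Lemma horner_map_modp (L : fieldType) (E : fieldType) (i : {rmorphism L -> E}) f g a :
  root (f ^ i) a -> ((g %% f) ^ i).[a] = (g ^ i).[a].
Proof.
move=> /rootP fa; rewrite {2}(divp_eq g f) rmorphD rmorphM !hornerE fa.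
by rewrite mulr0 add0r.
Qed.

Section Roots.
Variables (D : orderedRatModType) (E : closedFieldType) (v : E -> ext D).
Hypothesis vP : is_valuation v.

(** The coefficient of ['X^k] is a sum of products of [size r - k] roots;
    multiplying by [y ^+ k] avoids dividing values. *)
Lemma valuation_coef_prod_XsubC (r : seq E) y :
  (forall z, z \in r -> v y <= v z) ->
  forall k, v (y ^+ size r) <= v ((\prod_(z <- r) ('X - z%:P))`_k * y ^+ k).
Proof.
elim: r => [_ k|z r IHr yr k].
  rewrite big_nil coef1 /=; case: k => [|k]; first by rewrite mul1r.
  by rewrite mul0r (valuation0 vP) ext_le_None.
have {}IHr : forall k, v (y ^+ size r) <=
    v ((\prod_(z <- r) ('X - z%:P))`_k * y ^+ k).
  by apply: IHr => t rt; apply: yr; rewrite inE rt orbT.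
rewrite big_cons mulrBl coefB coefXM coefCM mulrBl /= exprS.
apply: (valuationD_ge vP).
  case: k => [|k] /=; first by rewrite mul0r (valuation0 vP) ext_le_None.
  by rewrite exprS mulrCA 2!(valuationM vP y) ext_leDl.
rewrite (valuationN vP) -mulrA (valuationM vP y) (valuationM vP z).
by rewrite ext_leD ?yr ?mem_head.
Qed.

Lemma valuation_prod_const (r : seq E) (f : E -> E) y :
  (forall z, z \in r -> v (f z) = v y) ->
  v (\prod_(z <- r) f z) = v (y ^+ size r).
Proof.
elim: r => [_|z r IHr fr]; first by rewrite big_nil.
rewrite big_cons exprS !(valuationM vP) fr ?mem_head // IHr // => t rt.
by rewrite fr // inE rt orbT.
Qed.

(** Without a root [z ~ y], each factor [y - z] of [q.[y]] has value [v y], so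
    [q.[y]] has the value of its leading term. But [q.[y]] is also
    [q.[y] - p.[y]], and every term of this difference has larger
    value: the terms of [p.[y]] have at least the value of its leading term,
    and the coefficients of [q - p] are negligible before those of [p]. *)
Lemma exists_sim_root (p q : {poly E}) y :
    p != 0 -> y != 0 -> root p y -> (forall k, sim_val v p`_k q`_k) ->
    (forall z, root p z -> v z = v y) -> (forall z, root q z -> v z = v y) ->
  exists2 z, root q z & sim_val v y z.
Proof.
move=> p0 y0 py pq vp vq; apply: contrapT => no_z.
have coef0 k : (p`_k == 0) = (q`_k == 0) by exact: (sim_neq0 vP (pq k)).
have sizepq : size p = size q.
  apply/eqP; rewrite eqn_leq; apply/andP; split; apply/leq_sizeP => j sj.
    by apply/eqP; rewrite coef0 nth_default.
  by apply/eqP; rewrite -coef0 nth_default.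
have q0 : q != 0 by rewrite -size_poly_eq0 -sizepq size_poly_eq0.
have [r pE] := closed_field_poly_normal p.
have [s qE] := closed_field_poly_normal q.
have rootp z : root p z = (z \in r).
  by rewrite pE rootZ ?lead_coef_eq0 // root_prod_XsubC.
have rootq z : root q z = (z \in s).
  by rewrite qE rootZ ?lead_coef_eq0 // root_prod_XsubC.
have sizer : size r = (size p).-1.
  by rewrite pE size_scale ?lead_coef_eq0 // size_prod_XsubC.
have sizes : size s = (size p).-1.
  by rewrite sizepq qE size_scale ?lead_coef_eq0 // size_prod_XsubC.
pose c := lead_coef p * y ^+ size r.
have c0 : c != 0 by rewrite mulf_neq0 ?lead_coef_eq0 ?expf_neq0.
have vqy : v q.[y] = v c.
  rewrite qE hornerZ horner_prod /c !(valuationM vP).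
  have <- : v (lead_coef p) = v (lead_coef q).
    by rewrite !lead_coefE -sizepq; apply: (sim_val_eq vP).
  congr ext_add; rewrite sizer -sizes.
  apply: valuation_prod_const => z; rewrite -rootq => qz; rewrite !hornerE /=.
  have ge_y : v y <= v (y - z).
    by apply: (valuationD_ge vP) => //; rewrite (valuationN vP) vq.
  apply/eqP; rewrite eq_le ge_y andbT leNgt.
  by apply/negP => yz; apply: no_z; exists z => //; rewrite sim_gt.
suff : v c < v (q.[y] - p.[y]) by rewrite (rootP py) subr0 vqy ltxx.
rewrite !horner_coef -sizepq -sumrB.
apply: (big_ind (fun x => v c < v x)) => [|x1 x2|k _].
- by rewrite (valuation0 vP) ext_lte_None (valuation_eq0 vP).
- exact: valuationD_gt.
have [pk0|pk0] := eqVneq p`_k 0.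
  rewrite pk0; have /eqP -> : q`_k == 0 by rewrite -coef0 pk0.
  by rewrite !mul0r subr0 (valuation0 vP) ext_lte_None (valuation_eq0 vP).
have lt_k : v (p`_k * y ^+ k) < v (q`_k * y ^+ k - p`_k * y ^+ k).
  rewrite -mulrBl ![_ * y ^+ k]mulrC !(valuationM vP) ext_ltDl //.
    by rewrite (valuation_eq0 vP) expf_neq0.
  by rewrite (valuationB vP) -sim_gt.
apply: le_lt_trans lt_k; have -> : p`_k = lead_coef p * (\prod_(z <- r) ('X - z%:P))`_k.
  by rewrite -coefZ -pE.
rewrite /c -mulrA 2!(valuationM vP (lead_coef p)).
apply: ext_leDl; apply: valuation_coef_prod_XsubC => z.
by rewrite -rootp => /vp ->.
Qed.

Lemma sim_horner (p : {poly E}) (sigma : {rmorphism E -> E}) y y' :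
    sim_val v (lead_coef p) (sigma (lead_coef p)) -> sim_val v y y' ->
    (forall z, root p z -> sim_val v z (sigma z) /\ ~ sim_val v y z) ->
  sim_val v p.[y] (p ^ sigma).[y'].
Proof.
move=> lc_p yy' simz; have [->|p0] := eqVneq p 0.
  by rewrite rmorph0 !hornerC; apply: sim_refl.
have [r pE] := closed_field_poly_normal p.
have rootp z : root p z = (z \in r).
  by rewrite pE rootZ ?lead_coef_eq0 // root_prod_XsubC.
rewrite pE map_polyZ map_prod_XsubC !hornerZ !horner_prod.
apply: (sim_mul vP) => //; rewrite !big_seq; apply: (sim_prod vP) => z.
rewrite -rootp => /simz[zz' nyz]; rewrite !hornerE /=.
exact: sim_sub.
Qed.
End Roots.

(** * Extension of embeddings to the tame ramification group *)

Section Henselian.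
Variables (D : orderedRatModType) (K : fieldType) (E : closedFieldType).
Variables (iota : {rmorphism K -> E}) (v : E -> ext D).

Definition over_base (sigma : E -> E) := forall a, sigma (iota a) = iota a.

(** The composite of [v] with [sigma] is another extension of the valuation
    of [K]. *)
Lemma henselian_valuation_endo (vK : K -> ext D) :
  henselian iota vK -> extends_val iota vK v ->
  forall sigma : {rmorphism E -> E}, over_base sigma ->
  forall x, v (sigma x) = v x.
Proof.
move=> [_ [w [_ w_uniq]]] vext sigma sK x.
have [vP vE] := vext.
suff vs_ext : extends_val iota vK (v \o sigma).
  by rewrite -[LHS]/((v \o sigma) x) -(w_uniq _ vs_ext) (w_uniq _ vext).
split=> [|a /=]; last by rewrite sK vE.
split=> [y|y z|y z] /=.
- split=> [/(val_infty vP)/eqP|->]; last by rewrite rmorph0 (valuation0 vP).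
  by rewrite fmorph_eq0 => /eqP.
- by rewrite rmorphM (valuationM vP).
- by rewrite rmorphD (val_add vP).
Qed.

Hypothesis vP : is_valuation v.
Hypothesis v_endo : forall sigma : {rmorphism E -> E}, over_base sigma ->
  forall x, v (sigma x) = v x.
Hypothesis algK : is_algebraic_closure iota.

Local Notation "x \sim y" := (sim_val v x y) (at level 70).

Lemma sim_endo (sigma : {rmorphism E -> E}) x y : over_base sigma ->
  x \sim y -> sigma x \sim sigma y.
Proof.
move=> sK; have [->|x0] := eqVneq x 0; first by move/sim0 ->; apply: sim_refl.
by rewrite !sim_gt ?fmorph_eq0 // -rmorphB !v_endo.
Qed.

(** A partial embedding that preserves leading terms extends to an endomorphism
    that preserves all of them. The argument treats residue field extensions,
    ramification and wild extensions alike: at each stage an element whose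
    leading term is not yet attained in the domain is adjoined. *)
Lemma tame_extension (R0 : set (E * E)) :
  subfield_graph R0 -> (forall a, R0 (iota a, iota a)) ->
  (forall p, R0 p -> p.1 \sim p.2) ->
  exists tau : {rmorphism E -> E},
    (forall p, R0 p -> tau p.1 = p.2) /\ forall x, x \sim tau x.
Proof.
move=> gR0 R0K R0sim; have [R [gR R0R Rsim Rmax]] :=
  @exists_maximal_graph _ R0 (fun p => p.1 \sim p.2) gR0 R0sim.
have [L [i [rho RE]]] := graph_fieldP gR.
have iK a : exists2 x, i x = iota a & rho x = iota a.
  have /RE[x [eix erx]] : R (iota a, iota a) by exact/R0R/R0K.
  by exists x.
have algi : is_algebraic_closure i.
  by apply: is_algebraic_closure_sub algK => a; have [x] := iK a; exists x.
have [sigma si] := extend_endomorphism rho algi.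
have sK : over_base sigma by move=> a; have [x ix rx] := iK a; rewrite -{1}ix si.
have sim_i x : i x \sim rho x by apply: (Rsim (i x, rho x)); apply/RE; exists x.
(* If L attains all leading terms, any extension of rho preserves them. *)
have [imm|] := pselect (forall y, exists b, y \sim i b).
  exists sigma; split=> [p /R0R /RE[x ->]|y]; first exact: si.
  have [b yb] := imm y.
  apply: (sim_trans vP yb); apply: (sim_trans vP (sim_i b)); rewrite -si.
  exact/sim_endo/sim_sym.
move=> /existsNP[y0 /forallNP far_y0].
(* Minimality of f among the polynomials with a root of new leading term makes
   f irreducible, and makes the roots of smaller polynomials similar to
   elements of L. *)
pose far (f : {poly L}) := f != 0 /\
  exists2 y, root (f ^ i) y & forall b, ~ y \sim i b.
have [|f [f0 [y fy far_y]] min_f] := @exists_min_size L far.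
  by have [f f0 fy0] := algi y0; exists f; split=> //; exists y0.
have f_irr : irreducible_poly f.
  apply/(subfx_irreducibleP fy f0) => q qy q0.
  by apply: min_f; split=> //; exists y.
have y_neq0 : y != 0.
  apply/eqP => y0E; apply: (far_y 0); rewrite y0E rmorph0; exact: sim_refl.
have [y' fy' yy'] : exists2 y', root (f ^ rho) y' & y \sim y'.
  apply: (@exists_sim_root _ _ _ vP (f ^ i)) => // [||z fz|z fz].
  - by rewrite map_poly_eq0.
  - by move=> k; rewrite !coef_map; apply: sim_i.
  - have [tau ti <-] := extend_endomorphism_root algi f_irr fy fz.
    by apply: v_endo => a; have [x <- _] := iK a; rewrite ti.
  - have [tau ti <-] := extend_endomorphism_root algi f_irr fy fz.
    by apply: v_endo => a; have [x ix rx] := iK a; rewrite -{1}ix ti.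
have gR' := adjoin_root_graph f_irr fy fy'.
have /RE[x [yE _]] : R (y, y'); last first.
  by case: (far_y x); rewrite yE; apply: sim_refl.
apply: (Rmax _ gR') => [p /RE[x ->]|p [g _ <-] /=|].
- by exists x%:P => //; rewrite !map_polyC !hornerC.
- rewrite -(horner_map_modp g fy) -(horner_map_modp g fy').
  set h := g %% f.
  have -> : h ^ rho = (h ^ i) ^ sigma.
    by rewrite -map_poly_comp; apply: eq_map_poly => a /=; rewrite si.
  have [->|h0] := eqVneq h 0; first by rewrite !rmorph0 !hornerC; apply: sim_refl.
  apply: sim_horner => // [|z hz].
    by rewrite lead_coef_map si; apply: sim_i.
  have [b zb] : exists b, z \sim i b.
    apply: contrapT => /forallNP far_z.
    have : far h by split=> //; exists z.
    by move/min_f; rewrite leqNgt ltn_modp f0.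
  split; last by move=> yz; apply: (far_y b); apply: sim_trans zb.
  apply: (sim_trans vP zb); apply: (sim_trans vP (sim_i b)); rewrite -si.
  exact/sim_endo/sim_sym.
- by exists 'X => //; rewrite !map_polyX !hornerX.
Qed.

End Henselian.

(** * Averaging over conjugate roots *)

Section Average.
Variables (K : fieldType) (E : closedFieldType) (iota : {rmorphism K -> E}).
Hypothesis algK : is_algebraic_closure iota.

Lemma map_poly_over_base (sigma : {rmorphism E -> E}) (p : {poly K}) :
  over_base iota sigma -> (p ^ iota) ^ sigma = p ^ iota.
Proof. by move=> sK; rewrite -map_poly_comp; apply: eq_map_poly => a /=; rewrite sK. Qed.

Lemma root_over_base (sigma : {rmorphism E -> E}) (p : {poly K}) x :
  over_base iota sigma -> root (p ^ iota) x -> root (p ^ iota) (sigma x).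
Proof. by move=> sK px; rewrite -(map_poly_over_base p sK) fmorph_root. Qed.

Variable A : seq E.
Hypothesis A_stable : forall sigma : {rmorphism E -> E}, over_base iota sigma ->
  forall x, x \in A -> sigma x \in A.

Let T := seq_sub A.

Section RootPerm.
Variables (sigma : {rmorphism E -> E}) (sK : over_base iota sigma).
Definition root_map (x : T) : T := SeqSub (A_stable sK (valP x)).
Lemma root_map_inj : injective root_map.
Proof. by move=> x y /(congr1 val) /= /fmorph_inj /val_inj. Qed.
Definition root_perm : {perm T} := perm root_map_inj.
Lemma root_permE x : val (root_perm x) = sigma (val x).
Proof. by rewrite permE. Qed.
End RootPerm.

(** The permutations of [A] induced by endomorphisms over [K]; this finite
    group replaces the Galois group in averages, without a choice of a finite
    normal extension and whether or not the roots are separable. *)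
Definition root_perms : {set {perm T}} :=
  [set s : {perm T} | `[< exists2 sigma : {rmorphism E -> E}, over_base iota sigma &
                        forall x, val (s x) = sigma (val x) >] ].

Lemma root_permsP (s : {perm T}) : reflect
  (exists2 sigma : {rmorphism E -> E}, over_base iota sigma &
     forall x, val (s x) = sigma (val x))
  (s \in root_perms).
Proof. by rewrite inE; apply: asboolP. Qed.

Lemma group_set_root_perms : group_set root_perms.
Proof.
apply/group_setP; split=> [|s t].
  by apply/root_permsP; exists idfun => // x; rewrite perm1.
move=> /root_permsP[f fK sE] /root_permsP[g gK tE]; apply/root_permsP.
pose h : {rmorphism E -> E} := g \o f.
exists h => [a|x]; first by rewrite /h /= fK gK.
by rewrite permM tE sE.
Qed.
Canonical root_perms_group := Group group_set_root_perms.

Lemma mem_root_perm (sigma : {rmorphism E -> E}) (sK : over_base iota sigma) :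
  root_perm sK \in root_perms.
Proof. by apply/root_permsP; exists sigma => // x; apply: root_permE. Qed.

(** Each permutation [s] rearranges the roots [z] of [p], with multiplicities,
    so [p.[theta]] is the product of [theta - s z] over [z]. Take the product
    over [s] and exchange: by transitivity each root contributes the same
    product as [a]. *)
Lemma horner_power_average (p : {poly K}) (theta : E) (a : T) :
    p \is monic -> irreducible_poly p -> root (p ^ iota) (val a) ->
    (forall x, root (p ^ iota) x -> x \in A) ->
  (p ^ iota).[theta] ^+ #|root_perms| =
  (\prod_(s in root_perms) (theta - val (s a))) ^+ deg p.
Proof.
move=> p_mon p_irr pa pA.
have [r pE] := closed_field_poly_normal (p ^ iota).
move: pE; rewrite (monicP (monic_map iota p_mon)) scale1r => pE.
have rootp z : root (p ^ iota) z = (z \in r) by rewrite pE root_prod_XsubC.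
have sizer : size r = deg p.
  by rewrite /deg -(size_map_poly iota) pE size_prod_XsubC.
have pos_s s : s \in root_perms ->
    (p ^ iota).[theta] = \prod_(z <- r) (theta - val (s (insubd a z))).
  move=> /root_permsP[f fK sE].
  rewrite -(map_poly_over_base p fK) pE map_prod_XsubC horner_prod.
  rewrite !big_seq; apply: eq_bigr => z; rewrite -rootp => pz.
  by rewrite !hornerE sE insubdK //; apply: pA.
rewrite -prodr_const (eq_bigr _ pos_s) exchange_big /=.
pose c := \prod_(s in root_perms) (theta - val (s a)).
suff orbit_prod z : z \in r ->
    \prod_(s in root_perms) (theta - val (s (insubd a z))) = c.
  rewrite big_seq (eq_bigr (fun=> c) orbit_prod) -big_seq.
  by rewrite big_const_seq count_predT sizer iter_mulr_1.
rewrite -rootp => pz.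
have [sigma sK sz] := extend_endomorphism_root algK p_irr pa pz.
have -> : insubd a z = root_perm sK a.
  by apply: val_inj; rewrite insubdK ?root_permE //; apply: pA.
rewrite [c](reindex_inj (mulgI (root_perm sK))) /=.
apply: eq_big => [s|s _]; first by rewrite groupMl ?mem_root_perm.
by rewrite permM.
Qed.

End Average.

(** An inequality between [v q.[theta] / deg q] and [v p.[theta] / deg p], where
    the denominators are cleared by the order [N] of the group. *)
Lemma valuation_horner_average (D : orderedRatModType) (K : fieldType)
    (E : closedFieldType) (iota : {rmorphism K -> E}) (v : E -> ext D)
    (p q : {poly K}) (alpha omega theta : E) :
    is_valuation v -> is_algebraic_closure iota ->
    p \is monic -> irreducible_poly p -> root (p ^ iota) alpha ->
    q \is monic -> irreducible_poly q -> root (q ^ iota) omega ->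
    (forall sigma : {rmorphism E -> E}, over_base iota sigma ->
       v (theta - sigma omega) <= v (theta - sigma alpha)) ->
  exists2 N, (0 < N)%N &
    v ((q ^ iota).[theta] ^+ (deg p * N)) <= v ((p ^ iota).[theta] ^+ (deg q * N)).
Proof.
move=> vP algK p_mon p_irr pa q_mon q_irr qo le_sigma.
have [A AE] := closed_field_poly_normal ((p * q) ^ iota).
have rootA x : root ((p * q) ^ iota) x = (x \in A).
  rewrite AE rootZ ?root_prod_XsubC // lead_coef_eq0 map_poly_eq0.
  by rewrite mulf_neq0 ?irredp_neq0.
have A_stable (sigma : {rmorphism E -> E}) : over_base iota sigma ->
    forall x, x \in A -> sigma x \in A.
  by move=> sK x; rewrite -!rootA; apply: root_over_base.
have pA x : root (p ^ iota) x -> x \in A by rewrite -rootA rmorphM rootM => ->.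
have qA x : root (q ^ iota) x -> x \in A.
  by rewrite -rootA rmorphM rootM orbC => ->.
exists #|root_perms iota A|; first exact: (cardG_gt0 (root_perms_group iota A)).
have avg_p := horner_power_average algK A_stable theta
  (a := SeqSub (pA _ pa)) p_mon p_irr pa pA.
have avg_q := horner_power_average algK A_stable theta
  (a := SeqSub (qA _ qo)) q_mon q_irr qo qA.
rewrite ![(_ * #|_|)%N]mulnC !exprM avg_p avg_q -!exprM mulnC.
apply: (valuationX_le2 vP); apply: (valuation_prod_le vP) => s.
by move=> /root_permsP[sigma sK sE]; rewrite !sE; apply: le_sigma.
Qed.

(** * Okutsu equivalence and tame parts *)

Section Main.
Variables (D : orderedRatModType) (K : fieldType) (E : closedFieldType).
Variables (iota : {rmorphism K -> E}) (v : E -> ext D).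
Hypothesis vP : is_valuation v.
Hypothesis v_endo : forall sigma : {rmorphism E -> E}, over_base iota sigma ->
  forall x, v (sigma x) = v x.
Hypothesis algK : is_algebraic_closure iota.

Lemma mem_Zroots (p : {poly K}) x : p != 0 ->
  (x \in Zroots iota p) = root (p ^ iota) x.
Proof.
move=> p0; rewrite /Zroots; case: closed_field_poly_normal => r /= pE.
by rewrite [in RHS]pE rootZ ?root_prod_XsubC // lead_coef_eq0 map_poly_eq0.
Qed.

(** For surjectivity: an endomorphism permutes the finitely many roots of a
    polynomial over [K]. *)
Lemma is_gal_endo (tau : {rmorphism E -> E}) :
  over_base iota tau -> is_gal iota tau.
Proof.
move=> tauK; split=> // [|x y _ _|x y _ _]; [|exact: rmorphD|exact: rmorphM].
split=> [x [p [p_mon p_irr p_sep px]]|x y _ _|y [p [p_mon p_irr p_sep py]]].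
- by exists p; split=> //; apply: root_over_base.
- exact: fmorph_inj.
have p0 := irredp_neq0 p_irr.
have stable (sigma : {rmorphism E -> E}) : over_base iota sigma ->
    forall x, x \in Zroots iota p -> sigma x \in Zroots iota p.
  by move=> sK x; rewrite !mem_Zroots //; apply: root_over_base.
have yZ : y \in Zroots iota p by rewrite mem_Zroots.
pose x := ((root_perm stable tauK)^-1)%g (SeqSub yZ).
exists (val x); last by rewrite -(root_permE stable tauK) permKV.
by exists p; split=> //; rewrite -mem_Zroots //; apply: valP.
Qed.

(** An endomorphism [sigma] fixing [omega] preserves leading terms on
    [K(theta)], because these are leading terms of elements of [K(omega)]. *)
Lemma tame_part_subset (F G : {poly K}) (theta omega : E) :
    irreducible_poly F -> root (F ^ iota) theta ->
    irreducible_poly G -> root (G ^ iota) omega ->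
    (forall g : {poly K}, (size g < size F)%N ->
      sim_val v (g ^ iota).[theta] (g ^ iota).[omega]) ->
  tame_part iota v (adjoin iota theta) `<=` tame_part iota v (adjoin iota omega).
Proof.
move=> F_irr Ft G_irr Go sim_g c [[g [h [h0 cE]]] c_tame]; split=> //.
have [[p [_ _ p_sep pc]] c_fix] := c_tame.
have [L [i [rho RE]]] := graph_fieldP (adjoin_root_graph G_irr Go Go).
have iE (q : {poly K}) : exists x, i x = (q ^ iota).[omega].
  have [|x [-> _]] := (RE ((q ^ iota).[omega], (q ^ iota).[omega])).1.
    by exists q.
  by exists x.
have iK a : exists x, i x = iota a.
  by have [x xE] := iE a%:P; exists x; rewrite xE map_polyC hornerC.
have [q qp] := map_poly_lift iK p.
have [||sigma si|x xc] :=
    @fixed_separable_in_range _ _ i q c (is_algebraic_closure_sub iK algK).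
- by rewrite -(separable_map i) qp separable_map.
- by rewrite qp.
- have sK : over_base iota sigma by move=> a; have [x <-] := iK a; apply: si.
  have so (r : {poly K}) : sigma (r ^ iota).[omega] = (r ^ iota).[omega].
    by have [x <-] := iE r; apply: si.
  have s_theta (r : {poly K}) : (r ^ iota).[sigma theta] = sigma (r ^ iota).[theta].
    by rewrite -[in LHS](map_poly_over_base r sK) horner_map.
  (* tau is in the tame ramification group and agrees with sigma on K(theta). *)
  have gR := adjoin_root_graph F_irr Ft (root_over_base sK Ft).
  have [a||tau [tauR tau_sim]] := tame_extension vP v_endo algK gR.
  + by exists a%:P => //; rewrite !map_polyC !hornerC.
  + move=> _ [r _ <-] /=; rewrite s_theta -(horner_map_modp r Ft).
    have sim_r : sim_val v ((r %% F) ^ iota).[theta] ((r %% F) ^ iota).[omega].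
      by apply: sim_g; rewrite ltn_modp irredp_neq0.
    apply: (sim_trans vP sim_r); rewrite -so.
    by apply: (sim_endo vP v_endo sK); apply: sim_sym.
  have tauE (r : {poly K}) : tau (r ^ iota).[theta] = sigma (r ^ iota).[theta].
    by rewrite -s_theta; apply: (tauR (_, _)); exists r.
  have tauK : over_base iota tau.
    by move=> a; have := tauE a%:P; rewrite map_polyC hornerC => ->; apply: sK.
  have <- : tau c = sigma c by rewrite cE !fmorph_div !tauE.
  apply: c_fix; split; first exact: is_gal_endo.
  by move=> x _; apply: sim_sym.
have [r _ [rE _]] := (RE (i x, rho x)).2 (ex_intro _ x erefl).
exists r, 1; rewrite rmorph1 hornerC oner_neq0 divr1; split=> //.
by rewrite rE.
Qed.

Section Okutsu.
Variables (F G : {poly K}) (theta omega : E).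
Hypothesis F_irr : irreducible_poly F.
Hypotheses (G_mon : G \is monic) (G_irr : irreducible_poly G).
Hypotheses (Ft : root (F ^ iota) theta) (Go : root (G ^ iota) omega).
Hypothesis FG : okutsu_equiv iota v F G.
Hypothesis omega_max : forall omega', root (G ^ iota) omega' ->
  v (theta - omega') <= v (theta - omega).

Lemma v_at_root (g : {poly K}) : v_at iota v F g = v (g ^ iota).[theta].
Proof.
rewrite /v_at; set x := chosen_root iota F.
have Fx : root (F ^ iota) x.
  have : theta \in Zroots iota F by rewrite mem_Zroots ?irredp_neq0.
  rewrite -mem_Zroots ?irredp_neq0 // /x /chosen_root.
  by case: (Zroots iota F) => [//|y r _]; apply: mem_head.
have [sigma sK <-] := extend_endomorphism_root algK F_irr Fx Ft.
by rewrite -[in RHS](map_poly_over_base g sK) horner_map v_endo.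
Qed.

(** If [alpha] were as close to [theta] as [omega] is, then [sigma alpha] and
    [sigma omega] would be at least as close as [theta] and [omega], hence as
    [theta] and [sigma omega]. So [theta] would be at least as close to
    [sigma alpha] as to [sigma omega] for every [sigma], and averaging over
    [sigma] would bound [v_F(G)] by [deg G] times the weight. *)
Lemma okutsu_root_closer (g : {poly K}) alpha :
    g != 0 -> (size g < size F)%N -> root (g ^ iota) alpha ->
  v (theta - alpha) < v (theta - omega).
Proof.
move=> g0 ltgF ga; rewrite ltNge; apply/negP => le_alpha.
have [degFG [_ [w [_ w_max] ->]]] := FG; rewrite v_at_root => lt_w.
have [p [p_mon p_irr pa]] := exists_monic_irreducible (algK alpha).
have p_gt0 : (0 < deg p)%N by rewrite /deg -subn1 subn_gt0; case: p_irr.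
have ltpF : (deg p < deg F)%N.
  have lepg : (size p <= size g)%N.
    by rewrite dvdp_leq // -(root_irreducible g p_irr pa).
  rewrite /deg -ltnS prednK ?(ltn_predK ltgF) ?(leq_ltn_trans lepg) //.
  by rewrite size_poly_gt0 irredp_neq0.
have [|N N_gt0] := valuation_horner_average (theta := theta) vP algK
  p_mon p_irr pa G_mon G_irr Go.
  move=> sigma sK; have vs : v (theta - omega) <= v (sigma omega - sigma alpha).
    rewrite -rmorphB v_endo // -(subrKA theta omega (- alpha)).
    by apply: (valuationD_ge vP) => //; rewrite (valuationB vP).
  have le_max := omega_max (root_over_base sK Go).
  rewrite -(subrKA (sigma omega) theta (- sigma alpha)).
  by apply: (valuationD_ge vP) => //; apply: le_trans vs.
apply/negP; rewrite -ltNge.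
have le_w : v (p ^ iota).[theta] <= Some (w *+ deg p).
  by apply: ext_le_divn => //; rewrite -v_at_root; apply: w_max; rewrite p_gt0.
apply: (le_lt_trans (valuationX_le vP (deg G * N) le_w)).
have -> : w *+ deg p *+ (deg G * N) = w *+ deg F *+ (deg p * N).
  by rewrite -!mulrnA degFG mulnA [(deg p * deg G)%N]mulnC mulnA.
by apply: (valuationX_gt vP) => //; rewrite muln_gt0 p_gt0.
Qed.

Lemma okutsu_sim_horner (g : {poly K}) : (size g < size F)%N ->
  sim_val v (g ^ iota).[theta] (g ^ iota).[omega].
Proof.
move=> ltgF; have [->|g0] := eqVneq g 0.
  by rewrite rmorph0 !hornerC; apply: sim_refl.
have [r gE] := closed_field_poly_normal (g ^ iota).
have rootg z : root (g ^ iota) z = (z \in r).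
  by rewrite gE rootZ ?root_prod_XsubC // lead_coef_eq0 map_poly_eq0.
rewrite gE !hornerZ !horner_prod.
apply: (sim_mul vP); first exact: sim_refl.
rewrite !big_seq; apply: (sim_prod vP) => z; rewrite -rootg => gz.
rewrite !hornerE /=; have lt_z := okutsu_root_closer g0 ltgF gz.
have z0 : theta - z != 0.
  by rewrite -(valuation_eq0 vP) -ext_lte_None; apply: lt_le_trans lt_z (ext_le_None _).
by rewrite sim_gt // opprB addrA subrK.
Qed.
End Okutsu.

End Main.

Theorem theorem5p16
  (D : orderedRatModType) (K : fieldType) (Kbar : closedFieldType)
  (iota : {rmorphism K -> Kbar}) (Kbar_closure : is_algebraic_closure iota)
  (vK : K -> ext D) (vK_hens : henselian iota vK)
  (vK_hull : is_divisible_hull vK)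
  (v : Kbar -> ext D) (v_ext : extends_val iota vK v)
  (F G : {poly K}) (HF : Pdless iota v F) (HG : Pdless iota v G)
  (F_sep : separable_poly F) (G_sep : separable_poly G)
  (FG : okutsu_equiv iota v F G)
  (theta omega : Kbar)
  (theta_in : theta \in Zroots iota F) (omega_in : omega \in Zroots iota G)
  (omega_max : forall omega' : Kbar, omega' \in Zroots iota G ->
     v (theta - omega') <= v (theta - omega)) :
  tame_part iota v (adjoin iota theta) = tame_part iota v (adjoin iota omega).
Proof.
have v_endo := henselian_valuation_endo vK_hens v_ext.
have [vP _] := v_ext.
have [_ F_irr _ _] := HF; have [G_mon G_irr _ _] := HG.
have F0 := irredp_neq0 F_irr; have G0 := irredp_neq0 G_irr.
rewrite mem_Zroots // in theta_in; rewrite mem_Zroots // in omega_in.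
have sim_g := okutsu_sim_horner vP v_endo Kbar_closure F_irr G_mon G_irr
  theta_in omega_in FG (fun x Gx => omega_max x (etrans (mem_Zroots iota x G0) Gx)).
have sizeFG : size F = size G.
  have [] := FG; rewrite /deg => degFG _.
  by rewrite -[LHS]prednK ?size_poly_gt0 // degFG prednK ?size_poly_gt0.
apply/seteqP; split.
  exact: (tame_part_subset vP v_endo Kbar_closure F_irr theta_in G_irr omega_in).
apply: (tame_part_subset vP v_endo Kbar_closure G_irr omega_in F_irr theta_in).
by move=> g ltgG; apply: (sim_sym vP); apply: sim_g; rewrite sizeFG.
Qed.
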